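(* Let $L$ be a triangulation of the $k$-dimensional simplex such that the only vertices of $L$ on the boundary of the simplex are the original vertices of the simplex. For a simplicial complex $K$ and any generalized Tchebyshev triangulation $K'$ of $K$ induced by $L$, the flag $f$-polynomial $$f_c(K';x,y)=\sum_{\sigma\in K'} x^{|\sigma\cap V(K)|}\,y^{|\sigma\cap (V(K')\setminus V(K))|}$$ depends only on the $f$-vector of $K$, in a linear fashion (for the fixed $L$), and is independent of the particular choice of $K'$. That is, given $L$, there exist linear functionals $l_{i,j}:\mathbb{R}[z]\to\mathbb{R}$ ($i,j\ge 0$) such that for every simplicial complex $K$ and every generalized Tchebyshev triangulation $K'$ of $K$ induced by $L$, $$f_c(K';x,y)=\sum_{i,j} l_{i,j}(f(K,z))\,x^iy^j .$$
   Context: Simplicial complexes are finite abstract simplicial complexes, containing the empty face; $k\geq 1$. $V(K)$ denotes the vertex set of $K$. The link of a face $\sigma$ of $K$ is $\mathrm{link}_K(\sigma)=\{\tau\in K: \sigma\cap\tau=\emptyset,\ \sigma\cup\tau\in K\}$. $f_i(K)$ is the number of $i$-dimensional faces (faces with $i+1$ vertices), and $f(K,z)=\sum_{i=0}^{\dim K+1} f_{i-1}(K)z^i$ is the $f$-polynomial. $\partial(L)$ denotes the subcomplex of boundary faces of $L$, which is the boundary complex of the original $k$-simplex. All vertices of $L$ that are not in $V(\partial(L))$ lie in the interior of the simplex. A simplicial complex $K'$ is a generalized Tchebyshev triangulation of $K$ induced by $L$ if there is an ordered list $\sigma_1,\ldots,\sigma_m$ of the $k$-dimensional faces of $K$, listing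 each exactly once, bijections $\phi_{\sigma_i}:V(\partial(L))\to\sigma_i$, and simplicial complexes $K_0=K,K_1,\ldots,K_m=K'$ such that for each $i\geq 1$ the complex $K_i$ is obtained from $K_{i-1}$ as follows: take an isomorphic copy $L_i$ of $L$ in which each boundary vertex $w\in V(\partial(L))$ is identified with $\phi_{\sigma_i}(w)$ and the interior vertices are new vertices, and replace the family of faces $\{\sigma_i\cup\tau:\tau\in\mathrm{link}_{K_{i-1}}(\sigma_i)\}$ by the family $\{\sigma'\cup\tau:\sigma'\in L_i,\ \tau\in\mathrm{link}_{K_{i-1}}(\sigma_i)\}$. In particular $V(K)\subseteq V(K')$. *)

(* Defs.v *)
From mathcomp Require Import all_boot all_order all_algebra.
From mathcomp Require Export finmap.
From mathcomp Require Import boolp classical_sets reals.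

Set Implicit Arguments.
Unset Strict Implicit.
Unset Printing Implicit Defensive.

Import Order.TTheory GRing.Theory Num.Theory.

Local Open Scope fset_scope.
Local Open Scope ring_scope.

(** * Finite abstract simplicial complexes *)

Section Complexes.
Variable W : choiceType.
Implicit Types (K : {fset {fset W}}) (s t : {fset W}).

Definition simplicial_complex K : Prop :=
  fset0 \in K /\ forall s t, s \in K -> t `<=` s -> t \in K.

Definition vertices K : {fset W} := \bigcup_(s <- K) s.

Definition link K s : {fset {fset W}} :=
  [fset t in K | (s `&` t == fset0) && (s `|` t \in K)].

(* dim K + 1, with dim K = -1 when fset0 is the only face. *)
Definition dimS K : nat := \max_(s <- K) #|` s|.

(* The number of faces with i vertices, i.e. of dimension i - 1. *)
Definition fm1 K (i : nat) : nat := #|` [fset s in K | #|` s| == i]|.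

Definition f_poly (R : realType) K : {poly R} :=
  \sum_(0 <= i < (dimS K).+1) (fm1 K i)%:R *: 'X^i.

(* The variable x is the outer 'X and y is the inner one, 'Y = 'X%:P. *)
Definition flag_f_poly (R : realType) K K' : {poly {poly R}} :=
  \sum_(s <- K') 'X^#|` s `&` vertices K|
                 * 'Y ^+ #|` s `&` (vertices K' `\` vertices K)|.

End Complexes.

(* p is the formal sum of a i j * x^i * y^j over all i, j; since p is a
   polynomial, all but finitely many coefficients a i j must vanish. *)
Definition is_formal_sum (R : realType) (p : {poly {poly R}})
    (a : nat -> nat -> R) : Prop :=
  exists N : nat,
    (forall i j : nat, (N <= i)%N || (N <= j)%N -> a i j = 0) /\
    p = \sum_(0 <= i < N) \sum_(0 <= j < N) (a i j)%:P%:P * ('X^i * 'Y ^+ j).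

(** * Geometric triangulations of the simplex *)

Section Triangulations.
Variables (R : realType) (n : nat).
Implicit Types (A s t : {fset 'rV[R]_n}) (x v : 'rV[R]_n)
               (L : {fset {fset 'rV[R]_n}}).

Definition conv_hull A : set 'rV[R]_n :=
  [set x | exists w : 'rV[R]_n -> R,
     [/\ forall v, v \in A -> 0 <= w v,
         \sum_(v <- A) w v = 1 & x = \sum_(v <- A) w v *: v]].

Definition affinely_independent A : Prop :=
  forall w : 'rV[R]_n -> R,
    \sum_(v <- A) w v = 0 -> \sum_(v <- A) w v *: v = 0 ->
    forall v, v \in A -> w v = 0.

Definition geometric_complex L : Prop :=
  [/\ simplicial_complex L,
      forall s, s \in L -> affinely_independent s
    & forall s t, s \in L -> t \in L ->
        (conv_hull s `&` conv_hull t = conv_hull (s `&` t)%fset)%classic].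

(* The (n - 1)-dimensional standard simplex; its vertices are the points
   [delta_mx 0 i]. *)
Definition std_simplex : set 'rV[R]_n :=
  [set x | (forall i, 0 <= x 0 i) /\ \sum_i x 0 i = 1].

Definition std_simplex_boundary : set 'rV[R]_n :=
  [set x | std_simplex x /\ exists i, x 0 i = 0].

Definition simplex_triangulation L : Prop :=
  geometric_complex L /\
  [set x | exists2 s, s \in L & conv_hull s x]%classic = std_simplex.

Definition only_original_boundary_vertices L : Prop :=
  forall v, v \in vertices L -> std_simplex_boundary v ->
    exists i, v = delta_mx 0 i.

Definition bdry L : {fset {fset 'rV[R]_n}} :=
  [fset s in L | `[< (conv_hull s `<=` std_simplex_boundary)%classic >]].

End Triangulations.

(** * Generalized Tchebyshev triangulations *)

Section Tchebyshev.
Variables (R : realType) (n : nat) (W : choiceType).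
Variable L : {fset {fset 'rV[R]_n}}.
Implicit Types (K : {fset {fset W}}) (s : {fset W}) (phi : 'rV[R]_n -> W).

Definition boundary_bijection phi s : Prop :=
  {in vertices (bdry L) &, injective phi} /\ phi @` vertices (bdry L) = s.

(* The isomorphic copy of L consists of the images [g @` s'] of the faces s'
   of L, where g is injective on the vertices of L. *)
Definition replacement_step K s phi K' : Prop :=
  exists g : 'rV[R]_n -> W,
    [/\ {in vertices L &, injective g},
        {in vertices (bdry L), g =1 phi},
        forall v, v \in vertices L `\` vertices (bdry L) -> g v \notin vertices K
      & K' = (K `\` [fset s `|` t | t in link K s])
             `|` [fset (g @` s') `|` t | s' : {fset 'rV[R]_n} in L,
                                               t : {fset W} in link K s]].

(* The faces that are replaced have as many vertices as the points of L have
   coordinates: n = k + 1 when L triangulates the k-dimensional simplex. *)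
Definition gen_tchebyshev_triangulation K K' : Prop :=
  exists (ss : seq {fset W}) (phi : {fset W} -> 'rV[R]_n -> W)
         (C : nat -> {fset {fset W}}),
    [/\ uniq ss /\ (forall s, s \in ss = (s \in K) && (#|` s| == n)),
        forall s, s \in ss -> boundary_bijection (phi s) s,
        C 0%N = K /\ C (size ss) = K',
        forall i, (i <= size ss)%N -> simplicial_complex (C i)
      & forall i, (i < size ss)%N ->
          replacement_step (C i) (nth fset0 ss i) (phi (nth fset0 ss i))
                           (C i.+1)].

End Tchebyshev.

(* Main.v *)
From HB Require Import structures.
Require Import Defs.
From mathcomp Require Import all_boot all_order all_algebra.
From mathcomp Require Import boolp classical_sets reals.
From mathcomp Require Import zify.

Set Implicit Arguments.
Unset Strict Implicit.
Unset Printing Implicit Defensive.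

Import Order.TTheory GRing.Theory Num.Theory.

Local Open Scope fset_scope.
Local Open Scope ring_scope.

(** Every replacement step rewrites faces one at a time: a face containing the
    k-face [s] under subdivision is [s `|` t] with [t] in the link of [s], and
    it is traded for the faces [A `|` t], where [A] runs over the faces of the
    copy of L that are not proper faces of [s].  Write V for the old vertices,
    n = k + 1 for the number of vertices of a k-face and B for the vertices of
    the boundary of L.

    Suppose first that B is not a face of L.  Then every such [A] contains an
    interior vertex and fewer than n boundary vertices, so the recursion

      r d = x^d                                        for d < n,
      r (n + j) = sum_A y^|A \ B| * r (|A & B| + j)

    determines a sequence of polynomials r.  It is made so that the potential
    sum_F y^|F \ V| * r |F & V| over the faces F of the current complex is
    the same before and after a step ([step_weight]): a face [s `|` t]
    contributes r (n + j) with j = |t & V|, and the right-hand side is what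
    the faces replacing it contribute.  The order of the steps and the way in
    which L is glued in leave no trace in this identity.

    For K itself the potential is sum_F r |F|, a linear expression in the
    f-vector.  In K' every face has fewer than n old vertices, because no k-face
    of K survives ([final_old_part]), so there the potential is the flag
    f-polynomial.  Hence the functional l_(i,j) sends z^d to the coefficient of
    x^i y^j in r d.

    If B is a face of L, it fills the whole simplex, so L has no other vertices
    ([trivial_triangulation]); each step then changes nothing, K' = K, and
    r d = x^d works for all d.  This is the only place where geometry enters. *)

(** * Faces and sums over finite sets *)

Section Faces.
Variable W : choiceType.
Implicit Types (K : {fset {fset W}}) (s t : {fset W}).

Lemma verticesP K v : reflect (exists2 s, s \in K & v \in s) (v \in vertices K).
Proof.
apply: (iffP (bigfcupP _ _ _ _)) => [[s]|[s]]; first by rewrite andbT; exists s.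
by exists s; rewrite ?andbT.
Qed.

Lemma face_sub_vertices K s : s \in K -> s `<=` vertices K.
Proof. by move=> sK; apply/fsubsetP => v vs; apply/verticesP; exists s. Qed.

Lemma vertex_face K v :
  simplicial_complex K -> v \in vertices K -> [fset v] \in K.
Proof.
case=> _ Kdown /verticesP[s sK vs]; apply: (Kdown s) => //.
by rewrite fsub1set.
Qed.

(** Closure under subsets puts [t] in K as soon as [s `|` t] is. *)
Lemma linkP K s t : simplicial_complex K ->
  reflect ([disjoint s & t] /\ s `|` t \in K)%fset (t \in link K s).
Proof.
case=> _ Kdown; rewrite !inE /= fsetI_eq0.
apply: (iffP and3P) => [[_ -> ->]//|[-> stK]]; split=> //.
by apply: Kdown stK _; rewrite fsubsetUr.
Qed.

Lemma subset_of_card s n : (n <= #|` s|)%N ->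
  exists2 t, t `<=` s & #|` t| = n.
Proof.
move=> le_n; exists [fset x in take n s]; last first.
  rewrite card_fseq undup_id ?size_takel //; exact: take_uniq.
by apply/fsubsetP => x; rewrite !inE => /mem_take.
Qed.

End Faces.

Lemma cardfsU_disjoint (I : choiceType) (A B : {fset I}) :
  [disjoint A & B]%fset -> #|` A `|` B| = (#|` A| + #|` B|)%N.
Proof. by rewrite -fsetI_eq0 cardfsU => /eqP ->; rewrite cardfs0 subn0. Qed.

Lemma fsetUDK (I : choiceType) (A B : {fset I}) : A `<=` B -> A `|` (B `\` A) = B.
Proof. by move/fsetIidPr => {1}<-; rewrite fsetID. Qed.

Lemma big_fsetU_disjoint (I : choiceType) (M : nmodType) (A B : {fset I})
    (F : I -> M) : [disjoint A & B]%fset ->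
  \sum_(i <- A `|` B) F i = \sum_(i <- A) F i + \sum_(i <- B) F i.
Proof.
move=> dAB; rewrite (big_fsetID _ (mem A)) /=; congr (_ + _).
  apply: eq_fbigl => x; rewrite !inE /=.
  by case: (x \in A); rewrite ?andbF.
apply: eq_fbigl => x; rewrite !inE /=.
case: (boolP (x \in A)) => /= xA; last by rewrite andbT.
by rewrite (negPf (fdisjointP dAB _ xA)).
Qed.

(** * Triangulations having the whole simplex as a face *)

Section Geometry.
Variables (R : realType) (n : nat).
Implicit Types (A : {fset 'rV[R]_n}) (L : {fset {fset 'rV[R]_n}}).

Definition simplex_vertices : {fset 'rV[R]_n} :=
  [fset delta_mx 0 i | i : 'I_n in 'I_n].

Lemma simplex_verticesE A :
  (forall v, v \in A -> exists i, v = delta_mx 0 i) -> #|` A| = n ->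
  A = simplex_vertices.
Proof.
move=> A_delta cardA; apply/eqP; rewrite eqEfcard; apply/andP; split.
  by apply/fsubsetP => v /A_delta[i ->]; apply/imfsetP; exists i.
rewrite cardA; apply: leq_trans (leq_imfset_card _ _ _) _ => /=.
by rewrite -cardE card_ord.
Qed.

Lemma conv_hull_vertex A v : v \in A -> conv_hull A v.
Proof.
move=> vA; exists (fun u => (u == v)%:R); split.
- by move=> u _; rewrite ler0n.
- rewrite (big_fsetD1 v) //= eqxx big1_fset ?addr0 // => u.
  by rewrite !inE => /andP[/negPf -> _].
- rewrite (big_fsetD1 v) //= eqxx scale1r big1_fset ?addr0 // => u.
  by rewrite !inE => /andP[/negPf -> _] _; rewrite scale0r.
Qed.

Lemma conv_hull_nonempty A v : conv_hull A v -> A != fset0.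
Proof.
case=> w [_ w1 _]; apply/eqP => A0; move: w1; rewrite A0 big_seq_fset0.
by move/eqP; rewrite eq_sym oner_eq0.
Qed.

Lemma std_simplex_conv_hull v : std_simplex v -> conv_hull simplex_vertices v.
Proof.
move=> [v0 v1].
have dinj : injective (fun i : 'I_n => delta_mx 0 i : 'rV[R]_n).
  move=> i j /matrixP/(_ 0 i); rewrite !mxE !eqxx /=.
  by case: (i =P j) => // _ /eqP; rewrite oner_eq0.
have sumE (M : nmodType) (F : 'rV[R]_n -> M) :
    \sum_(u <- simplex_vertices) F u = \sum_(i < n) F (delta_mx 0 i).
  rewrite big_imfset /=; last by move=> i j _ _; exact: dinj.
  by rewrite big_enum.
(* The weight of a unit vector is the matching coordinate of v; the sum
   selects it from the vector, and its other terms are absent. *)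
exists (fun u => \sum_(i | u == delta_mx 0 i) v 0 i).
have pick i : \sum_(j | (delta_mx 0 i : 'rV[R]_n) == delta_mx 0 j) v 0 j = v 0 i.
  rewrite (bigD1 i) //= big1 ?addr0 // => j /andP[/eqP/dinj ->].
  by rewrite eqxx.
split.
- by move=> u _; apply: sumr_ge0.
- by rewrite sumE; under eq_bigr do rewrite pick.
- by rewrite sumE; under eq_bigr do rewrite pick; exact: row_sum_delta.
Qed.

(** The boundary vertices are unit vectors, and being n in number they are all
    of them.  A face spanned by them covers the simplex, so it meets [conv_hull
    [fset v]] for every vertex v of L; since faces meet in common faces only, v
    is one of its vertices. *)
Lemma trivial_triangulation L :
  simplex_triangulation L -> only_original_boundary_vertices L ->
  #|` vertices (bdry L)| = n -> vertices (bdry L) \in L ->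
  vertices L `<=` vertices (bdry L).
Proof.
move=> [[Lcx _ Lmeet] Lcover] Lbd cardB BL; set B := vertices _ in cardB BL *.
have BE : B = simplex_vertices.
  apply: simplex_verticesE cardB => v /verticesP[s].
  rewrite !inE /= => /andP[sL /asboolP sb] vs.
  apply: Lbd; last by apply/sb/conv_hull_vertex.
  by apply/verticesP; exists s.
apply/fsubsetP => v vL.
have v1L := vertex_face Lcx vL.
have v1v : conv_hull [fset v] v by apply: conv_hull_vertex; rewrite inE.
have vS : std_simplex v by rewrite -Lcover; exists [fset v].
have vB : conv_hull B v by rewrite BE; exact: std_simplex_conv_hull.
have : conv_hull ([fset v] `&` B) v by rewrite -Lmeet.
by move/conv_hull_nonempty/fset0Pn => [u]; rewrite !inE => /andP[/eqP ->].
Qed.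

End Geometry.

(** * A single replacement step *)

Section Step.
Variables (R : realType) (n : nat) (W : choiceType).
Variable L : {fset {fset 'rV[R]_n}}.
Let B := vertices (bdry L).

(** When [B] is not a face of L, these are exactly the faces of L that have a
    vertex in the interior of the simplex, so gluing them in never recreates an
    old face. *)
Definition interior_faces := [fset s in L | ~~ (s `<=` B)].

Lemma bdry_vertices_sub : B `<=` vertices L.
Proof.
apply/fsubsetP => v /verticesP[s]; rewrite !inE /= => /andP[sL _] vs.
by apply/verticesP; exists s.
Qed.

Variables (C C' : {fset {fset W}}) (s : {fset W}) (phi : 'rV[R]_n -> W).
Hypothesis C_complex : simplicial_complex C.
Hypothesis s_card : #|` s| = n.
Hypothesis phi_bij : boundary_bijection L phi s.

Let star := [fset s `|` t | t in link C s].

Lemma card_boundary_bijection : #|` B| = n.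
Proof. by case: phi_bij s_card => phi_inj <-; rewrite card_in_imfset. Qed.

Section Copy.
Variable g : 'rV[R]_n -> W.
Hypothesis g_inj : {in vertices L &, injective g}.
Hypothesis g_phi : {in B, g =1 phi}.

Lemma image_boundary A : A `<=` B -> g @` A `<=` s.
Proof.
case: phi_bij => _ <- AB; apply/fsubsetP => _ /imfsetP[v /= vA ->].
have vB := fsubsetP AB v vA.
by rewrite g_phi //; apply/imfsetP; exists v.
Qed.

Lemma image_all_boundary : g @` B = s.
Proof.
case: phi_bij => _ <-; apply: eq_in_imfset => // v; exact: g_phi.
Qed.

Lemma card_image A : A `<=` vertices L -> #|` g @` A| = #|` A|.
Proof.
move=> AL; rewrite card_in_imfset //= => u v uA vA.
by apply: g_inj; apply: (fsubsetP AL).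
Qed.

End Copy.

Lemma trivial_step : vertices L `<=` B -> B \in L ->
  replacement_step L C s phi C' -> C' = C.
Proof.
move=> LB BL [g [g_inj g_phi _ ->]]; apply/fsetP => F.
have [_ Cdown] := C_complex.
apply/fsetUP/idP => [[/fsetDP[]//|]|FC].
  move=> /imfset2P[A /= AL [t /= /(linkP s t C_complex)[_ stC] ->]].
  apply: Cdown stC _; apply: fsetSU; apply: (image_boundary g_phi).
  exact: fsubset_trans (face_sub_vertices AL) LB.
case: (boolP (F \in star)) => [|Fs]; last by left; apply/fsetDP.
move=> /imfsetP[t /= tl ->]; right; apply/imfset2P; exists B => //.
by exists t; rewrite // (image_all_boundary g_phi).
Qed.

(** The boundary faces of the copy contribute only faces that survive the
    removal anyway: they are proper subsets of [s], so [A `|` t] is a face of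
    [s `|` t] that does not contain [s].  Dropping them makes the union
    disjoint. *)
Lemma step_decomposition g : B \notin L ->
  {in vertices L &, injective g} -> {in B, g =1 phi} ->
  (C `\` star) `|` [fset g @` A `|` t | A : {fset 'rV[R]_n} in L,
                                        t : {fset W} in link C s]
  = (C `\` star) `|` [fset g @` A `|` t | A : {fset 'rV[R]_n} in interior_faces,
                                        t : {fset W} in link C s].
Proof.
move=> BnL g_inj g_phi; have [_ Cdown] := C_complex.
apply/eqP; rewrite eqEfsubset; apply/andP; split; last first.
  apply: fsetUS; apply/fsubsetP => F /imfset2P[A /= + [t /= tl ->]].
  by rewrite !inE => /andP[AL _]; apply/imfset2P; exists A => //; exists t.
rewrite fsubUset fsubsetUl /=.
apply/fsubsetP => F /imfset2P[A /= AL [t /= tl ->]].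
case: (boolP (A `<=` B)) => AB; last first.
  apply/fsetUP; right; apply/imfset2P; exists A; first by rewrite !inE AL.
  by exists t.
have /(linkP s t C_complex)[dst stC] := tl.
apply/fsetUP; left; apply/fsetDP; split.
  by apply: Cdown stC _; apply: fsetSU; apply: (image_boundary g_phi).
apply/negP => /imfsetP[u /= _ E].
have sgA : s `<=` g @` A.
  apply/fsubsetP => v vs; have : v \in g @` A `|` t by rewrite E inE vs.
  by case/fsetUP => // vt; move: (fdisjointP dst _ vs); rewrite vt.
have := fsubset_leq_card sgA.
rewrite card_image ?(fsubset_trans AB bdry_vertices_sub) // s_card => leA.
case/negP: BnL; suff /eqP <- : A == B by [].
by rewrite eqEfcard AB card_boundary_bijection.
Qed.

(** A vertex could disappear only if its singleton contained [s], which has at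
    least two elements. *)
Lemma step_vertices : (1 < n)%N -> replacement_step L C s phi C' ->
  vertices C `<=` vertices C'.
Proof.
move=> n1 [g [_ _ _ ->]]; apply/fsubsetP => v vC.
apply/verticesP; exists [fset v]; last by rewrite inE.
apply/fsetUP; left; apply/fsetDP; split; first exact: vertex_face.
apply/negP => /imfsetP[t _ /(congr1 (fun F : {fset W} => #|` F|))] /=.
rewrite cardfs1 => E; move: n1; rewrite -s_card.
by rewrite ltnNge E fsubset_leq_card // fsubsetUl.
Qed.

(** A face created by the step has a new vertex, so a face on the vertices of
    [C] was there before and has not been removed. *)
Lemma step_old_face F : B \notin L -> replacement_step L C s phi C' ->
  F \in C' -> F `<=` vertices C -> F \in C /\ ~~ (s `<=` F).
Proof.
move=> BnL [g [g_inj g_phi g_new ->]]; rewrite step_decomposition //.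
case/fsetUP => [/fsetDP[FC Fstar] _|].
  split=> //; apply: contra Fstar => sF; apply/imfsetP; exists (F `\` s) => /=.
    apply/(linkP _ _ C_complex); rewrite fsetUDK //; split=> //.
    by apply/fdisjointP => v vs; rewrite inE vs.
  by rewrite fsetUDK.
move=> /imfset2P[A /= + [t /= _ ->]] FC; rewrite !inE => /andP[AL].
case/fsubsetPn => v vA vB; have vL := fsubsetP (face_sub_vertices AL) v vA.
have /negP[] : g v \notin vertices C by apply: g_new; rewrite inE vB vL.
by apply: (fsubsetP FC); rewrite inE; apply/orP; left; apply/imfsetP; exists v.
Qed.

Section Potential.
Variables (M : comNzRingType) (Y : M) (r : nat -> M) (V : {fset W}).

(** The potential of a face; [V] plays the role of the vertex set of the complex
    from which the sequence of steps started, and [r] that of the solution of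
    the recursion [r_rec]. *)
Definition weight F := Y ^+ #|` F `\` V| * r #|` F `&` V|.

Hypothesis r_rec : forall j, r (n + j) =
  \sum_(A <- interior_faces) Y ^+ #|` A `\` B| * r (#|` A `&` B| + j).
Hypothesis V_old : V `<=` vertices C.
Hypothesis s_old : s `<=` V.

Lemma weight_star t : t \in link C s ->
  weight (s `|` t) = Y ^+ #|` t `\` V| * r (n + #|` t `&` V|).
Proof.
move=> /(linkP s t C_complex)[dst _]; rewrite /weight; congr (_ ^+ _ * r _).
  have /eqP sV : s `\` V == fset0 by rewrite fsetD_eq0.
  by rewrite fsetDUl sV fset0U.
rewrite fsetIUl (fsetIidPl s_old) cardfsU_disjoint ?s_card //.
by apply: fdisjointWr dst; exact: fsubsetIl.
Qed.

Section NewFaces.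
Variable g : 'rV[R]_n -> W.
Hypothesis g_inj : {in vertices L &, injective g}.
Hypothesis g_phi : {in B, g =1 phi}.
Hypothesis g_new :
  forall v, v \in vertices L `\` B -> g v \notin vertices C.

Lemma image_mem_boundary v : v \in B -> g v \in s.
Proof.
move=> vB; apply: (fsubsetP (image_boundary g_phi (fsubset_refl B))).
by apply/imfsetP; exists v.
Qed.

Lemma image_mem_old v : v \in vertices L -> (g v \in V) = (v \in B).
Proof.
move=> vL; apply/idP/idP => [|vB].
  apply: contraLR => vB; apply: contra (g_new (v := v) _); last by rewrite inE vB.
  exact: (fsubsetP V_old).
exact/(fsubsetP s_old)/image_mem_boundary.
Qed.

Lemma image_notin_link v t : v \in vertices L -> t \in link C s -> g v \notin t.
Proof.
move=> vL tl; have /(linkP s t C_complex)[dst _] := tl.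
case: (boolP (v \in B)) => vB.
  exact: (fdisjointP dst _ (image_mem_boundary vB)).
apply: contra (g_new (v := v) _); last by rewrite inE vB.
apply: fsubsetP; apply: face_sub_vertices.
by move: tl; rewrite !inE => /andP[].
Qed.

Lemma weight_new A t : A \in L -> t \in link C s ->
  weight (g @` A `|` t) =
  Y ^+ #|` t `\` V| * (Y ^+ #|` A `\` B| * r (#|` A `&` B| + #|` t `&` V|)).
Proof.
move=> AL tl; have AV := fsubsetP (face_sub_vertices AL).
have gAI : g @` A `&` V = g @` (A `&` B).
  apply/fsetP => w; apply/fsetIP/imfsetP => /= [[/imfsetP[v /= vA ->] gV]|].
    by exists v; rewrite // inE vA -image_mem_old ?AV.
  move=> [v]; rewrite inE => /andP[vA vB] ->.
  by rewrite image_mem_old ?AV //; split=> //; apply/imfsetP; exists v.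
have gAD : g @` A `\` V = g @` (A `\` B).
  apply/fsetP => w; apply/fsetDP/imfsetP => /= [[/imfsetP[v /= vA ->] gV]|].
    by exists v; rewrite // inE vA -image_mem_old ?AV // gV.
  move=> [v]; rewrite inE => /andP[vB vA] ->.
  by rewrite image_mem_old ?AV //; split=> //; apply/imfsetP; exists v.
have dgt : [disjoint g @` A & t]%fset.
  apply/fdisjointP => _ /imfsetP[v /= vA ->].
  by apply: image_notin_link => //; exact: AV.
have sub A' : A' `<=` A -> A' `<=` vertices L.
  by move=> A'A; apply: fsubset_trans A'A (face_sub_vertices AL).
rewrite /weight fsetDUl fsetIUl !cardfsU_disjoint; first last.
- exact: fdisjointWl (fsubsetDl _ _) (fdisjointWr (fsubsetDl _ _) dgt).
- exact: fdisjointWl (fsubsetIl _ _) (fdisjointWr (fsubsetIl _ _) dgt).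
rewrite gAI gAD !card_image ?sub ?fsubsetIl ?fsubsetDl //.
by rewrite exprD mulrA; congr (_ * _); rewrite mulrC.
Qed.

(** The part of [g @` A `|` t] in the image of L is [g @` A] and the rest is
    [t], as the link of [s] has no vertex in that image. *)
Lemma new_face_inj A t A' t' :
  A \in L -> t \in link C s -> A' \in L -> t' \in link C s ->
  g @` A `|` t = g @` A' `|` t' -> A = A' /\ t = t'.
Proof.
have recoverA A0 t0 v : A0 \in L -> t0 \in link C s ->
    (v \in A0) = (v \in vertices L) && (g v \in g @` A0 `|` t0).
  move=> AL tl; have AV := fsubsetP (face_sub_vertices AL).
  rewrite inE; apply/idP/andP => [vA|[vL]].
    by split; [exact: AV | apply/orP; left; apply/imfsetP; exists v].
  rewrite (negPf (image_notin_link vL tl)) orbF => /imfsetP[u /= uA].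
  by move/(g_inj vL (AV u uA)) ->.
have recovert A0 t0 : A0 \in L -> t0 \in link C s ->
    t0 = (g @` A0 `|` t0) `\` g @` vertices L.
  move=> AL tl; have AV := fsubsetP (face_sub_vertices AL).
  apply/fsetP => w; apply/idP/fsetDP => [wt|[/fsetUP[|//] + /negP[]]].
    split; first by rewrite inE wt orbT.
    by apply/imfsetP => -[v /= vL E]; move/negP: (image_notin_link vL tl);
       rewrite -E.
  by move=> /imfsetP[v /= vA ->]; apply/imfsetP; exists v; rewrite //= AV.
move=> AL tl AL' tl' E; split.
  by apply/fsetP => v; rewrite (recoverA A t) // (recoverA A' t') // E.
by rewrite (recovert A t) // (recovert A' t') // E.
Qed.

End NewFaces.

(** Both complexes are disjoint unions over the same faces kept by the step, and
    on the remaining parts, indexed by [t], the identity is [r_rec] at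
    [j = #|` t `&` V|]. *)
Lemma step_weight : B \notin L -> replacement_step L C s phi C' ->
  \sum_(F <- C') weight F = \sum_(F <- C) weight F.
Proof.
move=> BnL [g [g_inj g_phi g_new ->]]; rewrite step_decomposition //.
have star_sub : star `<=` C.
  by apply/fsubsetP => F /imfsetP[t /= /(linkP s t C_complex)[_ ?] ->].
rewrite -[in RHS](fsetUDK star_sub) [in RHS]fsetUC.
rewrite !big_fsetU_disjoint; first last.
- apply/fdisjointP => F /fsetDP[FC _]; apply/negP.
  move=> /imfset2P[A /= + [t /= _ E]]; rewrite !inE => /andP[AL].
  case/fsubsetPn => v vA vB; have vL := fsubsetP (face_sub_vertices AL) v vA.
  have /negP[] : g v \notin vertices C by apply: g_new; rewrite inE vB vL.
  apply: (fsubsetP (face_sub_vertices FC)); rewrite E inE.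
  by apply/orP; left; apply/imfsetP; exists v.
- by apply/fdisjointP => F /fsetDP[].
congr (_ + _); rewrite big_imfset2 /=; last first.
  have intL A0 : A0 \in interior_faces -> A0 \in L by rewrite !inE => /andP[].
  move=> [A t] [A' t'] /andP[/= /intL AL tl] /andP[/= /intL AL' tl'] E.
  by have [-> ->] := new_face_inj g_inj g_phi g_new AL tl AL' tl' E.
rewrite [in RHS]big_imfset /=; last first.
  move=> t t' /(linkP s t C_complex)[dst _] /(linkP s t' C_complex)[dst' _] E.
  have drop u : [disjoint s & u]%fset -> u = (s `|` u) `\` s.
    move=> /fdisjointP dsu; apply/fsetP => w; rewrite !inE.
    by case: (boolP (w \in s)) => //= /dsu /negPf.
  by rewrite (drop t) // (drop t') // E.
rewrite exchange_big /=; apply: eq_big_seq => t tl.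
rewrite weight_star // r_rec big_distrr /=.
rewrite big_seq [RHS]big_seq; apply: eq_bigr => A.
by rewrite !inE /= => /andP[AL _]; rewrite weight_new.
Qed.

End Potential.

End Step.

(** * Recursions and formal sums *)

(** The recursion is well founded since [m i + j < n + j].  An approximation
    with fuel [f] unfolds it [f] times, and [d.+1] unfoldings suffice at [d]. *)
Lemma solve_recursion (M : nmodType) (I : choiceType) (D : {fset I})
    (act : I -> M -> M) (m : I -> nat) (n : nat) (x : nat -> M) :
  (forall i, i \in D -> (m i < n)%N) ->
  exists r : nat -> M, (forall d, (d < n)%N -> r d = x d) /\
    forall j, r (n + j)%N = \sum_(i <- D) act i (r (m i + j)%N).
Proof.
move=> m_lt.
pose fix approx (f d : nat) {struct f} : M := if f is f'.+1 then
    if (d < n)%N then x d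
    else \sum_(i <- D) act i (approx f' (m i + (d - n))%N)
  else x d.
have approxS f d : approx f.+1 d =
  if (d < n)%N then x d else \sum_(i <- D) act i (approx f (m i + (d - n))%N).
  by [].
have stable d : forall f f', (d < f)%N -> (d < f')%N -> approx f d = approx f' d.
  elim/ltn_ind: d => d IH [//|f] [//|f'] df df'; rewrite !approxS.
  case: ltnP => // nd; apply: eq_big_seq => i iD; congr (act i _).
  by have := m_lt i iD => mi; apply: IH; lia.
exists (fun d => approx d.+1 d); split=> [d dn|j]; first by rewrite /= dn.
rewrite approxS ltnNge leq_addr addKn.
apply: eq_big_seq => i iD; congr (act i _).
by have := m_lt i iD => mi; apply: stable; lia.
Qed.

Lemma coef_sum_bound (R : nzRingType) (a : nat -> R) (p : {poly R}) N :
  (size p <= N)%N ->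
  \sum_(0 <= d < N) p`_d * a d = \sum_(0 <= d < size p) p`_d * a d.
Proof.
move=> le; rewrite (big_cat_nat (leq0n _) le) /= -[RHS]addr0; congr (_ + _).
rewrite big_nat_cond big1 // => d /andP[/andP[led _] _].
by rewrite nth_default // mul0r.
Qed.

(** The functional with prescribed values [a d] on the powers of the variable;
    the free upper bound [N] lets it be evaluated on a presentation of [p] whose
    length may exceed the size of [p]. *)
Lemma scalar_with_values (R : comNzRingType) (a : nat -> R) :
  exists l : {scalar {poly R}},
    forall (p : {poly R}) N, (size p <= N)%N -> l p = \sum_(0 <= d < N) p`_d * a d.
Proof.
pose l (p : {poly R}) : R := \sum_(0 <= d < size p) p`_d * a d.
have l_lin : linear_for *%R l.
  move=> c p q; pose N := maxn (size (c *: p + q)) (maxn (size p) (size q)).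
  rewrite /l -!(@coef_sum_bound _ a _ N) ?leq_max ?leqnn ?orbT //.
  rewrite big_distrr /= -big_split /=; apply: eq_bigr => d _.
  by rewrite coefD coefZ mulrDl mulrA.
pose lM := GRing.isLinear.Build _ _ _ _ l l_lin.
pose lS : {scalar {poly R}} := HB.pack l lM.
by exists lS => p N le; rewrite (coef_sum_bound _ le).
Qed.

Lemma poly_sum_bound (R : nzRingType) (p : {poly R}) N : (size p <= N)%N ->
  p = \sum_(0 <= i < N) p`_i *: 'X^i.
Proof.
move=> le; rewrite big_mkord -poly_def; apply/polyP => j; rewrite coef_poly.
by case: ltnP => // Nj; rewrite nth_default // (leq_trans le).
Qed.

Lemma formal_sum_coefs (R : realType) (p : {poly {poly R}}) :
  is_formal_sum p (fun i j => p`_i`_j).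
Proof.
pose N := maxn (size p) (\max_(i < size p) size (p`_i)%R)%N.
have sizeN i : (size (p`_i)%R <= N)%N.
  case: (ltnP i (size p)) => ip; last by rewrite nth_default ?size_poly0.
  rewrite leq_max; apply/orP; right.
  exact: (leq_bigmax (Ordinal ip)).
exists N; split=> [i j /orP[le|le]|].
- by rewrite [p`_i]nth_default ?coef0 // (leq_trans (leq_maxl _ _) le).
- by rewrite [LHS]nth_default // (leq_trans (sizeN i) le).
rewrite {1}(@poly_sum_bound _ p N) ?leq_maxl //; apply: eq_bigr => i _.
rewrite {1}(poly_sum_bound (sizeN i)) scaler_suml; apply: eq_bigr => j _.
by rewrite -!mul_polyC polyCM -mulrA -polyC_exp ['X^i * _]mulrC.
Qed.

(** * Sequences of replacement steps *)

Section Sequence.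
Variables (R : realType) (n : nat) (W : choiceType).
Variable L : {fset {fset 'rV[R]_n}}.
Let B := vertices (bdry L).
Variables (K : {fset {fset W}}) (ss : seq {fset W})
  (phi : {fset W} -> 'rV[R]_n -> W) (C : nat -> {fset {fset W}}).
Hypothesis n_gt1 : (1 < n)%N.
Hypothesis ssE : forall s, s \in ss = (s \in K) && (#|` s| == n).
Hypothesis phi_bij : forall s, s \in ss -> boundary_bijection L (phi s) s.
Hypothesis C0 : C 0%N = K.
Hypothesis C_complex : forall i, (i <= size ss)%N -> simplicial_complex (C i).
Hypothesis C_step : forall i, (i < size ss)%N ->
  replacement_step L (C i) (nth fset0 ss i) (phi (nth fset0 ss i)) (C i.+1).

Lemma sequence_face i : (i < size ss)%N ->
  nth fset0 ss i \in K /\ #|` nth fset0 ss i| = n.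
Proof. by move=> /(mem_nth fset0); rewrite ssE => /andP[? /eqP]. Qed.

Lemma sequence_vertices i : (i <= size ss)%N -> vertices K `<=` vertices (C i).
Proof.
elim: i => [|i IH] i_le; first by rewrite C0.
have [sK s_card] := sequence_face i_le.
apply: fsubset_trans (IH (ltnW i_le)) _.
exact: step_vertices (C_complex (ltnW i_le)) s_card n_gt1 (C_step i_le).
Qed.

Hypothesis B_notin : B \notin L.

(** A face on the original vertices was never created, and each step has removed
    those that contain its k-face. *)
Lemma sequence_old_face i F : (i <= size ss)%N -> F \in C i ->
  F `<=` vertices K ->
  F \in K /\ forall j, (j < i)%N -> ~~ (nth fset0 ss j `<=` F).
Proof.
elim: i => [|i IH] i_le; first by rewrite C0.
move=> FC FV; have [sK s_card] := sequence_face i_le.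
have FVi := fsubset_trans FV (sequence_vertices (ltnW i_le)).
have [FCi sF] := step_old_face (C_complex (ltnW i_le)) s_card
  (phi_bij (mem_nth fset0 i_le)) B_notin (C_step i_le) FC FVi.
have [FK IHj] := IH (ltnW i_le) FCi FV.
split=> // j; rewrite ltnS leq_eqVlt => /predU1P[->|] //; exact: IHj.
Qed.

(** With n or more old vertices, a final face would contain an n-subset that is
    a k-face of K, and all of these have been subdivided. *)
Lemma final_old_part F : F \in C (size ss) -> (#|` F `&` vertices K| < n)%N.
Proof.
move=> FC; have [_ Cdown] := C_complex (leqnn _).
have FVC : F `&` vertices K \in C (size ss).
  by apply: Cdown FC _; exact: fsubsetIl.
have [FVK no_s] := sequence_old_face (leqnn _) FVC (fsubsetIr _ _).
rewrite ltnNge; apply/negP => /subset_of_card[s sF s_card].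
have s_ss : s \in ss.
  rewrite ssE s_card eqxx andbT.
  have [_ Kdown] := C_complex (leq0n _).
  by rewrite -C0; apply: (Kdown _ s) sF; rewrite C0.
move: (no_s (index s ss)); rewrite index_mem nth_index // sF.
by move/(_ s_ss).
Qed.

Lemma sequence_weight (M : comNzRingType) (Y : M) (r : nat -> M) :
  (forall j, r (n + j)%N = \sum_(A <- interior_faces L)
     Y ^+ #|` A `\` B| * r (#|` A `&` B| + j)%N) ->
  \sum_(F <- C (size ss)) weight Y r (vertices K) F =
  \sum_(F <- K) weight Y r (vertices K) F.
Proof.
move=> r_rec; suff step i : (i <= size ss)%N ->
    \sum_(F <- C i) weight Y r (vertices K) F =
    \sum_(F <- K) weight Y r (vertices K) F by exact: step.
elim: i => [|i IH] i_le; first by rewrite C0.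
have [sK s_card] := sequence_face i_le.
rewrite -IH ?(ltnW i_le) //.
apply: (step_weight (C_complex (ltnW i_le)) s_card
  (phi_bij (mem_nth fset0 i_le)) r_rec) => //.
- exact: sequence_vertices (ltnW i_le).
- exact: face_sub_vertices.
- exact: C_step.
Qed.

End Sequence.

(** * The flag f-polynomial *)

Lemma flag_f_poly_weight (R : realType) (W : choiceType) (K K' : {fset {fset W}}) :
  flag_f_poly R K K' =
  \sum_(F <- K') weight ('X%:P) (fun d => 'X^d) (vertices K) F.
Proof.
apply: eq_big_seq => F FK; rewrite /weight mulrC; congr (_ ^+ #|` _| * _).
apply/fsetP => v; rewrite !inE.
case: (boolP (v \in F)) => [vF|]; rewrite ?andbF //= andbT.
by rewrite (fsubsetP (face_sub_vertices FK)) // andbT.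
Qed.

(** The polynomial [r d] is the contribution of all final faces that come from
    one face of K with d vertices. *)
Lemma flag_f_by_face_sizes (R : realType) (k : nat) (k_ge1 : (1 <= k)%N)
    (L : {fset {fset 'rV[R]_k.+1}}) :
  simplex_triangulation L -> only_original_boundary_vertices L ->
  exists r : nat -> {poly {poly R}},
    forall (W : choiceType) (K K' : {fset {fset W}}),
      simplicial_complex K -> gen_tchebyshev_triangulation L K K' ->
      flag_f_poly R K K' = \sum_(F <- K) r #|` F|.
Proof.
move=> Ltri Lbd; set n := k.+1; set B := vertices (bdry L).
have weightK (W : choiceType) (K : {fset {fset W}}) (r : nat -> {poly {poly R}}) :
    \sum_(F <- K) weight ('X%:P) r (vertices K) F = \sum_(F <- K) r #|` F|.
  apply: eq_big_seq => F /face_sub_vertices FV.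
  rewrite /weight (fsetIidPl FV); have /eqP -> : F `\` vertices K == fset0.
    by rewrite fsetD_eq0.
  by rewrite cardfs0 expr0 mul1r.
(* If [B] does not have n elements, K has no k-face that could be matched with
   it, so there are no steps; this joins the case where all steps are
   trivial. *)
have [degenerate|] := boolP ((B \in L) || (#|` B| != n)).
  exists (fun d => 'X^d) => W K K' _ [ss [phi [C [[_ ssE] phi_bij [C0 <-]]]]].
  move=> C_complex C_step; suff -> : C (size ss) = K.
    by rewrite flag_f_poly_weight weightK.
  suff: forall i, (i <= size ss)%N -> C i = K by apply.
  elim=> [|i IH] i_le; first by rewrite C0.
  have [sK s_card] := sequence_face ssE i_le.
  rewrite -[RHS]IH ?(ltnW i_le) //.
  have bij := phi_bij _ (mem_nth fset0 i_le).
  have cardB : #|` B| = n := card_boundary_bijection s_card bij.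
  have BL : B \in L by move: degenerate; rewrite cardB eqxx orbF.
  apply: (trivial_step (C_complex _ (ltnW i_le)) bij _ BL (C_step _ i_le)).
  exact: trivial_triangulation.
rewrite negb_or negbK => /andP[BL /eqP cardB].
have [[_ Ldown] _ _] := Ltri.1.
have few_boundary A : A \in interior_faces L -> (#|` A `&` B| < n)%N.
  rewrite !inE => /andP[AL _]; rewrite -cardB; apply: fproper_ltn_card.
  rewrite fproperEneq fsubsetIr andbT; apply: contra BL => /eqP <-.
  by apply: Ldown AL _; exact: fsubsetIl.
have [r [r_small r_rec]] := solve_recursion
  (fun A x => ('X%:P) ^+ #|` A `\` B| * x) (fun d => 'X^d : {poly {poly R}})
  few_boundary.
exists r => W K K' _ [ss [phi [C [[_ ssE] phi_bij [C0 <-]]]]] C_complex C_step.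
rewrite -weightK.
rewrite -(sequence_weight _ ssE phi_bij C0 C_complex C_step BL r_rec) //.
rewrite flag_f_poly_weight.
apply: eq_big_seq => F FC; rewrite /weight r_small //.
exact: (final_old_part _ ssE phi_bij C0 C_complex C_step BL).
Qed.

Lemma f_polyE (R : realType) (W : choiceType) (K : {fset {fset W}}) :
  f_poly R K = \poly_(i < (dimS K).+1) (fm1 K i)%:R.
Proof. by rewrite /f_poly big_mkord poly_def. Qed.

Lemma size_f_poly (R : realType) (W : choiceType) (K : {fset {fset W}}) :
  (size (f_poly R K) <= (dimS K).+1)%N.
Proof. by rewrite f_polyE size_poly. Qed.

Lemma sum_by_face_size (R : realType) (W : choiceType) (K : {fset {fset W}})
    (r : nat -> R) :
  \sum_(F <- K) r #|` F| = \sum_(0 <= d < (dimS K).+1) (f_poly R K)`_d * r d.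
Proof.
rewrite big_mkord f_polyE.
transitivity (\sum_(d < (dimS K).+1) \sum_(F <- K) (#|` F| == d)%:R * r d).
  rewrite exchange_big; apply: eq_big_seq => F FK /=.
  have dF : (#|` F| < (dimS K).+1)%N by rewrite ltnS; exact: leq_bigmax_seq.
  rewrite (bigD1 (Ordinal dF)) //= eqxx mul1r big1 ?addr0 // => d.
  by rewrite -val_eqE /= eq_sym => /negPf ->; rewrite mul0r.
apply: eq_bigr => d _; rewrite coef_poly ltn_ord -big_distrl /=; congr (_ * _).
rewrite -natr_sum /fm1 card_fset_sum1 big_fset /=; congr (_%:R).
by rewrite [RHS]big_mkcond; apply: eq_bigr => F _; case: eqP.
Qed.

Theorem theorem3p4 (R : realType) (k : nat) (k_ge1 : (1 <= k)%N)
    (L : {fset {fset 'rV[R]_k.+1}})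
    (L_triangulation : simplex_triangulation L)
    (L_boundary : only_original_boundary_vertices L) :
  exists l : nat -> nat -> {scalar {poly R}},
    forall (W : choiceType) (K K' : {fset {fset W}}),
      simplicial_complex K ->
      gen_tchebyshev_triangulation L K K' ->
      is_formal_sum (flag_f_poly R K K') (fun i j => l i j (f_poly R K)).
Proof.
have [r flagE] := flag_f_by_face_sizes k_ge1 L_triangulation L_boundary.
have [l lE] := choice (fun ij => scalar_with_values (fun d => (r d)`_ij.1`_ij.2)).
exists (fun i j => l (i, j)) => W K K' K_complex KK'.
suff -> : (fun i j => l (i, j) (f_poly R K)) =
          (fun i j => (flag_f_poly R K K')`_i`_j) by exact: formal_sum_coefs.
apply/funext => i; apply/funext => j.
rewrite (lE _ _ (dimS K).+1) ?size_f_poly //.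
rewrite -(sum_by_face_size K (fun d => (r d)`_i`_j)).
by rewrite (flagE _ _ _ K_complex KK') !coef_sum.
Qed.
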